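(* The set $\Omega$ of all positive integer solutions $(x,y)$ of the Pell equation $x^{2}-2y^{2}=-9$ is $$\Omega=\{(21B_{n-1}-3B_{n-2},\;15B_{n-1}-3B_{n-2}) : n\geq 1\},$$ where $B_k$ denotes the $k$-th balancing number.
   Context: Balancing numbers $B_k$ are defined by $B_0=0$, $B_1=1$, $B_k=6B_{k-1}-B_{k-2}$, and this recurrence is used to extend them to negative indices (so $B_{-1}=-1$, $B_{-2}=-6$). Equivalently $B_k=\frac{\alpha^{2k}-\beta^{2k}}{4\sqrt{2}}$ for all integers $k$, where $\alpha=1+\sqrt2$, $\beta=1-\sqrt2$. *)

(* Defs.v *)
From mathcomp Require Import all_boot all_order all_algebra.

Set Implicit Arguments.
Unset Strict Implicit.
Unset Printing Implicit Defensive.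

Import Order.TTheory GRing.Theory Num.Theory.
Local Open Scope ring_scope.

(* Both steps act on pairs (B_k, B_(k+1)) of consecutive terms and use the
   recurrence B_k = 6 B_(k-1) - B_(k-2), solved for the highest or for the
   lowest index. *)
Definition balancing_next (p : int * int) : int * int :=
  (p.2, 6 * p.2 - p.1).

Definition balancing_prev (p : int * int) : int * int :=
  (6 * p.1 - p.2, p.1).

(* Negz n is the integer - n.+1. *)
Definition balancing (k : int) : int :=
  match k with
  | Posz n => (iter n balancing_next (0, 1)).1
  | Negz n => (iter n.+1 balancing_prev (0, 1)).1
  end.

Lemma balancing0 : balancing 0 = 0. Proof. by []. Qed.

Lemma balancing1 : balancing 1 = 1. Proof. by []. Qed.

Lemma balancingN1 : balancing (-1) = -1. Proof. by []. Qed.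

Lemma balancingN2 : balancing (-2) = -6. Proof. by []. Qed.

Lemma balancing_rec (k : int) :
  balancing k = 6 * balancing (k - 1) - balancing (k - 2).
Proof.
case: k => [[|[|n]]|n] //.
- have -> : n.+2%:Z - 1 = n.+1%:Z by rewrite -[n.+2]addn1 PoszD addrK.
  have -> : n.+2%:Z - 2 = n%:Z by rewrite -[n.+2]addn2 PoszD addrK.
  by [].
- have -> : Negz n - 1 = Negz n.+1.
    by rewrite !NegzE -opprD -PoszD addn1.
  have -> : Negz n - 2 = Negz n.+2.
    by rewrite !NegzE -opprD -PoszD addn2.
  have -> : balancing (Negz n.+2) =
            6 * balancing (Negz n.+1) - balancing (Negz n) by [].
  by rewrite subKr.
Qed.

(* Main.v *)
Require Import Defs.
From mathcomp Require Import all_boot all_order all_algebra.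
From mathcomp Require Import classical_sets.
From mathcomp Require Import zify ring.

Set Implicit Arguments.
Unset Strict Implicit.
Unset Printing Implicit Defensive.

Import Order.TTheory GRing.Theory Num.Theory.
Local Open Scope classical_set_scope.
Local Open Scope ring_scope.

(** Multiplication by the unit 3 + 2 sqrt 2 of norm 1 maps a solution (x, y) to
    (3 x + 4 y, 2 x + 3 y), and the listed pairs are the orbit of (3, 3) under
    this map.  The inverse map keeps a positive solution positive and decreases
    y as soon as y >= 7, and (3, 3) is the only positive solution with y <= 6,
    so by descent on y every positive solution lies in the orbit. *)

Definition pell_sol (p : int * int) : Prop :=
  [/\ 0 < p.1, 0 < p.2 & p.1 ^+ 2 - 2 * p.2 ^+ 2 = - 9].

Definition pell_next (p : int * int) : int * int :=
  (3 * p.1 + 4 * p.2, 2 * p.1 + 3 * p.2).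

Definition pell_prev (p : int * int) : int * int :=
  (3 * p.1 - 4 * p.2, 3 * p.2 - 2 * p.1).

Lemma pell_prevK : cancel pell_prev pell_next.
Proof. by case=> x y; congr pair => /=; ring. Qed.

Lemma pell_sol_next p : pell_sol p -> pell_sol (pell_next p).
Proof.
case: p => x y [/= x0 y0 e]; split=> /=; [lia | lia |].
by rewrite -e; ring.
Qed.

(** Since [x ^+ 2 = 2 * y ^+ 2 - 9], positivity of [3 * x - 4 * y] amounts to [2 * y ^+ 2 > 81],
    whence the bound 7; the decrease amounts to [y < x], that is [y ^+ 2 > 9]. *)
Lemma pell_sol_prev p : 7 <= p.2 -> pell_sol p ->
  pell_sol (pell_prev p) /\ (pell_prev p).2 < p.2.
Proof.
case: p => x y /= y7 [/= x0 y0 e]; split; last by nia.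
by split=> /=; [nia | nia | rewrite -e; ring].
Qed.

Lemma pell_sol_small p : p.2 < 7 -> pell_sol p -> p = (3, 3).
Proof.
case: p => x y /= y7 [/= x0 y0 e].
(* Indeed [x ^+ 2 = 2 * y ^+ 2 - 9 <= 63]. *)
have x9 : x < 9 by nia.
case: x y x0 x9 y0 y7 e => [x|//] [y|//] _ + _.
(* The counts 7 and 9 exhaust [y < 7] and [x < 9]. *)
by move: y x; do 7! [case=> [|] //]; do 9! [case=> [|] //].
Qed.

Lemma pell_sol_iter n : pell_sol (iter n pell_next (3, 3)).
Proof. by elim: n => [|n IHn] //=; apply: pell_sol_next. Qed.

Lemma pell_sol_orbit p : pell_sol p -> exists n, p = iter n pell_next (3, 3).
Proof.
have [m] := ubnP `|p.2|%N; elim: m p => // m IHm p lt_m sol_p.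
have [p7|p7] := ltrP p.2 7; first by exists 0%N; apply: pell_sol_small.
have [sol_q lt_q] := pell_sol_prev p7 sol_p.
have [|n def_q] := IHm _ _ sol_q.
  by case: sol_q => _ q0 _; case: p lt_m lt_q q0 {sol_p p7} => x y /=; lia.
by exists n.+1; rewrite iterS -def_q pell_prevK.
Qed.

(** At [n = 0] the value B_(-1) = -1 yields (3, 3); the step matches coefficients after B_(n+1) = 6
    B_n - B_(n-1). *)
Lemma pell_iter_balancing n :
  iter n pell_next (3, 3) =
  (21 * balancing n%:Z - 3 * balancing (n%:Z - 1),
   15 * balancing n%:Z - 3 * balancing (n%:Z - 1)).
Proof.
elim: n => [|n IHn] //; rewrite iterS IHn.
rewrite (balancing_rec n.+1%:Z).
have -> : n.+1%:Z - 1 = n%:Z by lia.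
have -> : n.+1%:Z - 2 = n%:Z - 1 by lia.
by congr pair => /=; ring.
Qed.

Theorem theorem2p1 :
  [set p : int * int |
     [/\ 0 < p.1, 0 < p.2 & p.1 ^+ 2 - 2 * p.2 ^+ 2 = - 9]] =
  [set (21 * balancing (n%:Z - 1) - 3 * balancing (n%:Z - 2),
        15 * balancing (n%:Z - 1) - 3 * balancing (n%:Z - 2))
     | n in [set n : nat | (1 <= n)%N]].
Proof.
(* The listed family starts at index 1, the orbit at exponent 0. *)
have shift1 (n : nat) : n.+1%:Z - 1 = n%:Z by lia.
have shift2 (n : nat) : n.+1%:Z - 2 = n%:Z - 1 by lia.
apply/seteqP; split=> [p /pell_sol_orbit [n ->] | p [[|n] // _ <-]].
  by exists n.+1 => //; rewrite shift1 shift2 pell_iter_balancing.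
rewrite shift1 shift2 -pell_iter_balancing; exact: pell_sol_iter.
Qed.
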